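(* Let $n\ge 2$ and $d\ge 1$ be integers, let $\Gamma=\mathbb{Z}/d\mathbb{Z}$ with generator $\xi$, let $\zeta$ be a primitive $d$-th root of unity in $\mathbb{C}$, and let $A=\mathbb{C}[u^{\pm 1}]\rtimes\Gamma$, where $\xi(u)=\zeta u$. Then the Lie algebras $\mathfrak{sl}_n(A)$ and $\mathfrak{sl}_{nd}(\mathbb{C}[t^{\pm 1}])$ are isomorphic.
   Context: All algebras are over $\mathbb{C}$. For an associative unital algebra $A$, $\mathfrak{gl}_n(A)=\mathfrak{gl}_n\otimes A$ is the Lie algebra of $n\times n$ matrices over $A$ with the commutator bracket, and $\mathfrak{sl}_n(A)=[\mathfrak{gl}_n(A),\mathfrak{gl}_n(A)]$. For a ring $R$ with action of a group $\Gamma$, $R\rtimes \Gamma$ is the smash product, spanned by elements $a\gamma$ ($a\in R,\gamma\in \Gamma$) with product $(a_1\gamma_1)(a_2\gamma_2)=a_1\gamma_1(a_2)\gamma_1\gamma_2$. *)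

(* Defs.v *)
From HB Require Import structures.
From mathcomp Require Import all_boot all_order all_algebra all_fingroup.
From mathcomp Require Import all_solvable.
From mathcomp Require Import finmap boolp reals complex monalg.

Set Implicit Arguments.
Unset Strict Implicit.
Unset Printing Implicit Defensive.

Import GRing.Theory.
Local Open Scope fset_scope.
Local Open Scope ring_scope.

(** * Lie algebras *)

HB.mixin Record isLieAlgebra (K : fieldType) L of GRing.Lmodule K L := {
  lie : L -> L -> L;
  lie_linearl : forall y, linear (lie^~ y);
  lie_linearr : forall x, linear (lie x);
  liexx : forall x, lie x x = 0;
  lie_jacobi : forall x y z,
    lie x (lie y z) + lie y (lie z x) + lie z (lie x y) = 0
}.

#[short(type="lieAlgType")]
HB.structure Definition LieAlgebra (K : fieldType) :=
  { L of GRing.Lmodule K L & isLieAlgebra K L }.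

Definition lie_isomorphic (K : fieldType) (L1 L2 : lieAlgType K) : Prop :=
  exists f : {linear L1 -> L2},
    bijective f /\ {morph f : x y / lie x y >-> lie x y}.

(** ** The derived algebra [L, L]: the span of all brackets *)

Section Derived.
Context (K : fieldType) (L : lieAlgType K).

Definition derived_pred : {pred L} := fun x =>
  `[< exists (m : nat) (c : 'I_m -> K) (a b : 'I_m -> L),
        x = \sum_(i < m) c i *: lie (a i) (b i) >].

Lemma derived_submod : submod_closed derived_pred.
Proof.
split=> [|k x y].
  apply/asboolP; exists 0%N, (fun=> 0), (fun=> 0), (fun=> 0).
  by rewrite big_ord0.
move=> /asboolP[m [c [a [b ->]]]] /asboolP[m' [c' [a' [b' ->]]]].
pose glue T (u : 'I_m -> T) (v : 'I_m' -> T) (i : 'I_(m + m')) :=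
  match split i with inl j => u j | inr j => v j end.
apply/asboolP; exists (m + m')%N, (glue _ (fun i => k * c i) c'),
  (glue _ a a'), (glue _ b b').
rewrite big_split_ord /= scaler_sumr; congr (_ + _); apply: eq_bigr => i _.
  by rewrite scalerA /glue (unsplitK (inl i)).
by rewrite /glue (unsplitK (inr i)).
Qed.

HB.instance Definition _ :=
  GRing.isSubmodClosed.Build K L derived_pred derived_submod.

Lemma mem_lie_derived (x y : L) : lie x y \in derived_pred.
Proof.
apply/asboolP; exists 1%N, (fun=> 1), (fun=> x), (fun=> y).
by rewrite big_ord1 scale1r.
Qed.

Record derived : predArgType :=
  Derived { dval : L; _ : dval \in derived_pred }.

HB.instance Definition _ := [isSub for dval].
HB.instance Definition _ := [Choice of derived by <:].
HB.instance Definition _ := [SubChoice_isSubLmodule of derived by <:].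

Definition derived_lie (x y : derived) : derived :=
  Derived (mem_lie_derived (val x) (val y)).

Lemma derived_lie_linearl y : linear (derived_lie^~ y).
Proof. by move=> k x x'; apply: val_inj; rewrite /= lie_linearl. Qed.

Lemma derived_lie_linearr x : linear (derived_lie x).
Proof. by move=> k y y'; apply: val_inj; rewrite /= lie_linearr. Qed.

Lemma derived_liexx x : derived_lie x x = 0.
Proof. by apply: val_inj; rewrite /= liexx. Qed.

Lemma derived_lie_jacobi x y z :
  derived_lie x (derived_lie y z) + derived_lie y (derived_lie z x) +
  derived_lie z (derived_lie x y) = 0.
Proof. by apply: val_inj; rewrite /= lie_jacobi. Qed.

HB.instance Definition _ := isLieAlgebra.Build K derived
  derived_lie_linearl derived_lie_linearr derived_liexx derived_lie_jacobi.
End Derived.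

(** ** gl_n(A) and sl_n(A) *)

(* An alias is needed: the canonical module structure on ['M[A]_n] has
   scalars in [A], whereas gl_n(A) is a Lie algebra over the base field. *)
Definition gl (K : fieldType) (n : nat) (A : algType K) : Type := 'M[A]_n.

Section GeneralLinear.
Context (K : fieldType) (n : nat) (A : algType K).

HB.instance Definition _ := GRing.Zmodule.copy (gl n A) 'M[A]_n.

Definition gl_scale (k : K) (M : gl n A) : gl n A :=
  map_mx (fun a : A => k *: a) M.

Lemma gl_scaleA k l M : gl_scale k (gl_scale l M) = gl_scale (k * l) M.
Proof. by apply/matrixP=> i j; rewrite !mxE scalerA. Qed.

Lemma gl_scale1 : left_id 1 gl_scale.
Proof. by move=> M; apply/matrixP=> i j; rewrite !mxE scale1r. Qed.

Lemma gl_scaleDr : right_distributive gl_scale +%R.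
Proof. by move=> k M N; apply/matrixP=> i j; rewrite !mxE scalerDr. Qed.

Lemma gl_scaleDl M : {morph gl_scale^~ M : k l / k + l}.
Proof. by move=> k l; apply/matrixP=> i j; rewrite !mxE scalerDl. Qed.

HB.instance Definition _ := GRing.Zmodule_isLmodule.Build K (gl n A)
  gl_scaleA gl_scale1 gl_scaleDr gl_scaleDl.

Definition commutator_mx (M N : gl n A) : gl n A := M *m N - N *m M.

Lemma gl_scale_mull k (M N : 'M[A]_n) :
  gl_scale k M *m N = gl_scale k (M *m N).
Proof.
apply/matrixP=> i j; rewrite !mxE scaler_sumr.
by apply: eq_bigr => l _; rewrite mxE scalerAl.
Qed.

Lemma gl_scale_mulr k (M N : 'M[A]_n) :
  M *m gl_scale k N = gl_scale k (M *m N).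
Proof.
apply/matrixP=> i j; rewrite !mxE scaler_sumr.
by apply: eq_bigr => l _; rewrite mxE scalerAr.
Qed.

Lemma commutator_linearl N : linear (commutator_mx^~ N).
Proof.
move=> k M M'; rewrite /commutator_mx scalerBr.
rewrite [(_ + _) *m _]mulmxDl [_ *m (_ + _)]mulmxDr.
by rewrite gl_scale_mull gl_scale_mulr opprD addrACA.
Qed.

Lemma commutatorxx M : commutator_mx M M = 0.
Proof. exact: subrr. Qed.

Lemma commutator_linearr M : linear (commutator_mx M).
Proof.
move=> k N N'; rewrite /commutator_mx scalerBr.
rewrite [(_ + _) *m _]mulmxDl [_ *m (_ + _)]mulmxDr.
by rewrite gl_scale_mull gl_scale_mulr opprD addrACA.
Qed.

Lemma commutator_jacobi M N P :
  commutator_mx M (commutator_mx N P) + commutator_mx N (commutator_mx P M) +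
  commutator_mx P (commutator_mx M N) = 0.
Proof.
rewrite /commutator_mx !mulmxBl !mulmxBr !mulmxA !opprB.
rewrite [LHS](AC ((2*2)*(2*2)*(2*2))
  ((1*12)*(2*7)*(3*10)*(4*5)*(6*11)*(8*9))) /=.
by rewrite !addNr !subrr !addr0.
Qed.

HB.instance Definition _ := isLieAlgebra.Build K (gl n A)
  commutator_linearl commutator_linearr commutatorxx commutator_jacobi.
End GeneralLinear.

Definition sl (K : fieldType) (n : nat) (A : algType K) : lieAlgType K :=
  derived (gl n A).

(** * Laurent polynomials *)

(* [{malg K[int]}] is the space of finitely supported functions int -> K; a
   function [g] stands for the Laurent polynomial \sum_k g@_k u^k.  The library
   has no ring structure on it, since [int] is not a [monomType]. *)
Definition laurent (K : fieldType) : Type := {malg K[int]}.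

Section Laurent.
Context (K : fieldType).
Implicit Types f g h : laurent K.

HB.instance Definition _ := GRing.Lmodule.copy (laurent K) {malg K[int]}.

Definition laurent_mul f g : laurent K :=
  \sum_(i <- msupp f) \sum_(j <- msupp g) << f@_i * g@_j *g (i + j)%R >>.

Lemma laurent_mulEw (d1 d2 : {fset int}) f g :
  msupp f `<=` d1 -> msupp g `<=` d2 ->
  laurent_mul f g =
    \sum_(i <- d1) \sum_(j <- d2) << f@_i * g@_j *g (i + j)%R >>.
Proof.
move=> le1 le2; rewrite /laurent_mul (big_fset_incl _ le1) /=.
  apply/eq_bigr=> i _; apply/big_fset_incl => // j _ /mcoeff_outdom ->.
  by rewrite mulr0 monalgU0.
move=> i _ /mcoeff_outdom fi.
by rewrite big1 => // j _; rewrite fi mul0r monalgU0.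
Qed.

Lemma laurent_mulDl : left_distributive laurent_mul +%R.
Proof.
move=> f g h.
rewrite (@laurent_mulEw _ (msupp h) _ _ (msuppD_le f g)) //.
rewrite (@laurent_mulEw _ (msupp h) _ _ (fsubsetUl _ (msupp g))) //.
rewrite (@laurent_mulEw _ (msupp h) _ _ (fsubsetUr (msupp f) _)) //.
rewrite -big_split /=; apply/eq_bigr=> i _.
rewrite -big_split /=; apply/eq_bigr=> j _.
by rewrite [(f + g)@__]mcoeffD mulrDl monalgUD.
Qed.

Lemma laurent_mulC : commutative laurent_mul.
Proof.
move=> f g; rewrite /laurent_mul exchange_big /=.
by apply/eq_bigr=> i _; apply/eq_bigr=> j _; rewrite mulrC addrC.
Qed.

Lemma laurent_mulDr : right_distributive laurent_mul +%R.
Proof. by move=> f g h; rewrite !(laurent_mulC f) laurent_mulDl. Qed.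

Lemma laurent_mul0l : left_zero (0 : laurent K) laurent_mul.
Proof. by move=> g; rewrite /laurent_mul msupp0 big_seq_fset0. Qed.

Lemma laurent_mul0r : right_zero (0 : laurent K) laurent_mul.
Proof. by move=> g; rewrite laurent_mulC laurent_mul0l. Qed.

Lemma laurent_mulUU (a b : K) (i j : int) :
  laurent_mul << a *g i >> << b *g j >> = << a * b *g (i + j)%R >>.
Proof.
rewrite (laurent_mulEw msuppU_le msuppU_le) !big_seq_fset1.
by rewrite !mcoeffUU.
Qed.

Lemma laurentE f : f = \sum_(i <- msupp f) (<< f@_i *g i >> : laurent K).
Proof. exact: monalgE. Qed.

Lemma laurent_mul_suml (I : Type) (r : seq I) (F : I -> laurent K) g :
  laurent_mul (\sum_(i <- r) F i) g = \sum_(i <- r) laurent_mul (F i) g.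
Proof.
exact: (big_morph (laurent_mul^~ g) (fun _ _ => laurent_mulDl _ _ _)
  (laurent_mul0l _)).
Qed.

Lemma laurent_mul_sumr (I : Type) (r : seq I) (F : I -> laurent K) g :
  laurent_mul g (\sum_(i <- r) F i) = \sum_(i <- r) laurent_mul g (F i).
Proof.
exact: (big_morph (laurent_mul g) (fun _ _ => laurent_mulDr _ _ _)
  (laurent_mul0r _)).
Qed.

Lemma laurent_mulA : associative laurent_mul.
Proof.
move=> f g h; rewrite (laurentE f) !laurent_mul_suml; apply/eq_bigr=> i _.
rewrite (laurentE g) !(laurent_mul_suml, laurent_mul_sumr).
apply/eq_bigr=> j _.
rewrite (laurentE h) !laurent_mul_sumr; apply/eq_bigr=> k _.
by rewrite !laurent_mulUU mulrA addrA.
Qed.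

Definition laurent_one : laurent K := << 1 *g (0 : int) >>.

Lemma laurent_mul1 : left_id laurent_one laurent_mul.
Proof.
move=> f; rewrite [in LHS](laurentE f) laurent_mul_sumr [RHS]laurentE.
by apply/eq_bigr=> i _; rewrite laurent_mulUU mul1r add0r.
Qed.

Lemma laurent_one_neq0 : laurent_one != 0.
Proof. by rewrite monalgU_eq0 oner_eq0. Qed.

HB.instance Definition _ := GRing.Zmodule_isComNzRing.Build (laurent K)
  laurent_mulA laurent_mulC laurent_mul1 laurent_mulDl laurent_one_neq0.

Lemma laurentMUU (a b : K) (i j : int) :
  (<< a *g i >> : laurent K) * (<< b *g j >> : laurent K) =
    << a * b *g (i + j)%R >>.
Proof. exact: laurent_mulUU. Qed.

Lemma laurent_scaleU (k a : K) (i : int) :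
  k *: (<< a *g i >> : laurent K) = << k * a *g i >>.
Proof. by apply/malgP=> j; rewrite mcoeffZ !mcoeffU mulrnAr. Qed.

Lemma laurent_scaleAl (k : K) f g : k *: (f * g) = k *: f * g.
Proof.
have scaleE h : k *: h = (<< k *g (0 : int) >> : laurent K) * h.
  rewrite [in LHS](laurentE h) scaler_sumr.
  rewrite [in RHS](laurentE h) [RHS]laurent_mul_sumr.
  by apply/eq_bigr=> i _; rewrite laurent_scaleU laurent_mulUU add0r.
by rewrite !scaleE mulrA.
Qed.

HB.instance Definition _ :=
  GRing.Lmodule_isLalgebra.Build K (laurent K) laurent_scaleAl.
HB.instance Definition _ := GRing.Lalgebra_isComAlgebra.Build K (laurent K).

Definition laurent_var : laurent K := << 1 *g (1 : int) >>.
End Laurent.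

Arguments laurent_var {K}.

(** * Smash products *)

Record alg_action (K : fieldType) (gT : finGroupType) (B : algType K) :=
  AlgAction {
    act_fun :> gT -> {lrmorphism B -> B};
    act_id : forall b, act_fun 1%g b = b;
    act_mul : forall g h b, act_fun (g * h)%g b = act_fun g (act_fun h b)
  }.

(* A function [f] stands for \sum_g (f g) g. *)
Definition smash (K : fieldType) (gT : finGroupType) (B : algType K)
    (act : alg_action gT B) : Type := {ffun gT -> B}.

Section Smash.
Context (K : fieldType) (gT : finGroupType) (B : algType K).
Context (act : alg_action gT B).
Implicit Types x y z : smash act.

HB.instance Definition _ := GRing.Lmodule.copy (smash act) {ffun gT -> B}.

(* The coefficient of [g] in the product collects the terms (a h)(b h^-1 g). *)
Definition smash_mul x y : smash act :=
  [ffun g => \sum_(h : gT) x h * act h (y (h^-1 * g)%g)].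

Definition smash_elt (b : B) (g : gT) : smash act :=
  [ffun h => if h == g then b else 0].

Lemma smash_elt_mul a b g h :
  smash_mul (smash_elt a g) (smash_elt b h) = smash_elt (a * act g b) (g * h)%g.
Proof.
apply/ffunP=> k; rewrite !ffunE (bigD1 g) //= !ffunE eqxx big1 ?addr0.
  rewrite -(inj_eq (mulgI g) _ h) mulKVg.
  by case: ifP => // _; rewrite raddf0 mulr0.
by move=> l /negPf ne; rewrite ffunE ne mul0r.
Qed.

Lemma smash_mulA : associative smash_mul.
Proof.
move=> x y z; apply/ffunP=> g; rewrite !ffunE.
under eq_bigr => h _ do rewrite ffunE raddf_sum mulr_sumr.
under [RHS]eq_bigr => k _ do rewrite ffunE mulr_suml.
rewrite [RHS]exchange_big /=; apply/eq_bigr=> h _.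
rewrite [RHS](reindex_inj (mulgI h)) /=; apply/eq_bigr=> k _.
by rewrite rmorphM /= act_mul mulKg mulrA invMg mulgA.
Qed.

Definition smash_one : smash act := smash_elt 1 1%g.

Lemma smash_mul1l : left_id smash_one smash_mul.
Proof.
move=> x; apply/ffunP=> g; rewrite ffunE (bigD1 1%g) //= big1.
  by rewrite ffunE eqxx mul1r act_id invg1 mul1g addr0.
by move=> h /negPf ne; rewrite ffunE ne mul0r.
Qed.

Lemma smash_mul1r : right_id smash_one smash_mul.
Proof.
move=> x; apply/ffunP=> g; rewrite ffunE (bigD1 g) //= big1.
  by rewrite ffunE mulVg eqxx rmorph1 mulr1 addr0.
move=> h ne; rewrite ffunE -(inj_eq (mulgI h)) mulKVg mulg1 eq_sym (negPf ne).
by rewrite raddf0 mulr0.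
Qed.

Lemma smash_mulDl : left_distributive smash_mul +%R.
Proof.
move=> x y z; apply/ffunP=> g; rewrite !ffunE -big_split /=.
by apply/eq_bigr=> h _; rewrite ffunE mulrDl.
Qed.

Lemma smash_mulDr : right_distributive smash_mul +%R.
Proof.
move=> x y z; apply/ffunP=> g; rewrite !ffunE -big_split /=.
by apply/eq_bigr=> h _; rewrite ffunE raddfD mulrDr.
Qed.

Lemma smash_one_neq0 : smash_one != 0.
Proof.
by apply/eqP=> /ffunP/(_ 1%g)/eqP; rewrite !ffunE eqxx oner_eq0.
Qed.

HB.instance Definition _ := GRing.Zmodule_isNzRing.Build (smash act)
  smash_mulA smash_mul1l smash_mul1r smash_mulDl smash_mulDr smash_one_neq0.

Lemma smash_scaleAl (k : K) x y : k *: (x * y) = k *: x * y.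
Proof.
apply/ffunP=> g; rewrite !ffunE scaler_sumr.
by apply/eq_bigr=> h _; rewrite ffunE scalerAl.
Qed.

Lemma smash_scaleAr (k : K) x y : k *: (x * y) = x * (k *: y).
Proof.
apply/ffunP=> g; rewrite !ffunE scaler_sumr.
by apply/eq_bigr=> h _; rewrite ffunE linearZ scalerAr.
Qed.

HB.instance Definition _ :=
  GRing.Lmodule_isLalgebra.Build K (smash act) smash_scaleAl.
HB.instance Definition _ :=
  GRing.Lalgebra_isAlgebra.Build K (smash act) smash_scaleAr.
End Smash.

(** ** Rotation actions on Laurent polynomials *)

(* The twist [u |-> c *: u]; it only serves to show that a cyclic group of order
   [d] does act with its generator sending [u] to [zeta *: u]. *)
Section LaurentTwist.
Context (K : fieldType) (c : K) (c_neq0 : c != 0).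
Implicit Types f g : laurent K.

Definition laurent_twist of c != 0 := fun f : laurent K =>
  \sum_(i <- msupp f) (<< c ^ i * f@_i *g i >> : laurent K).
Local Notation twist := (laurent_twist c_neq0).

Lemma coef_twist f i : (twist f)@_i = c ^ i * f@_i.
Proof.
rewrite /laurent_twist (raddf_sum (mcoeff i)) /= [in RHS](laurentE f).
rewrite (raddf_sum (mcoeff i)) mulr_sumr; apply/eq_bigr=> j _ /=.
by rewrite !mcoeffU; case: eqP => [->|_]; rewrite ?mulr1n // !mulr0n mulr0.
Qed.

Lemma twistU a i : twist << a *g i >> = << c ^ i * a *g i >>.
Proof.
apply/malgP=> j; rewrite coef_twist !mcoeffU.
by case: eqP => [->|_]; rewrite ?mulr1n // !mulr0n mulr0.
Qed.

Lemma twist_linear : linear twist.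
Proof.
move=> k f g; apply/malgP=> i.
rewrite mcoeffD mcoeffZ !coef_twist [(k *: f + g)@__]mcoeffD.
by rewrite [(k *: f)@__]mcoeffZ mulrDr mulrCA.
Qed.

HB.instance Definition _ := GRing.isLinear.Build K _ _ _ twist twist_linear.

Lemma twist_monoid : monoid_morphism twist.
Proof.
split=> [|f g]; first by rewrite [LHS]twistU expr0z mul1r.
rewrite [in LHS](laurentE f) mulr_suml raddf_sum [in RHS](laurentE f).
rewrite raddf_sum mulr_suml; apply/eq_bigr=> i _.
rewrite [in LHS](laurentE g) mulr_sumr raddf_sum [in RHS](laurentE g).
rewrite raddf_sum mulr_sumr; apply/eq_bigr=> j _ /=.
rewrite laurentMUU !twistU laurentMUU.
by rewrite expfzDr // mulrACA.
Qed.

HB.instance Definition _ :=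
  GRing.isMonoidMorphism.Build _ _ twist twist_monoid.
End LaurentTwist.

Lemma rotation_action_exists (K : fieldType) (d : nat) (gT : finGroupType)
    (xi : gT) (zeta : K) :
  [set: gT]%g = <[xi]>%g -> #[xi]%g = d -> d.-primitive_root zeta ->
  exists act : alg_action gT (laurent K),
    act xi laurent_var = zeta *: laurent_var.
Proof.
move=> gen_xi ord_xi prim_zeta.
have log_ex g : exists i : nat, (xi ^+ i == g)%g.
  have /cycleP[i ->] : g \in <[xi]>%g by rewrite -gen_xi inE.
  by exists i.
pose log g := xchoose (log_ex g).
have logK g : (xi ^+ log g)%g = g by apply/eqP/(xchooseP (log_ex g)).
have log_mod i g : (xi ^+ i)%g = g -> zeta ^+ log g = zeta ^+ i.
  move=> e; apply/eqP; rewrite (eq_prim_root_expr prim_zeta) -ord_xi.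
  by rewrite -eq_expg_mod_order logK e.
have zeta_neq0 i : zeta ^+ i != 0.
  apply: expf_neq0; apply: contra_eq_neq (prim_expr_order prim_zeta) => ->.
  by rewrite expr0n gtn_eqF ?(prim_order_gt0 prim_zeta) // eq_sym oner_neq0.
pose rot g : {lrmorphism laurent K -> laurent K} :=
  laurent_twist (zeta_neq0 (log g)).
have rot1 b : rot 1%g b = b.
  apply/malgP=> i; rewrite coef_twist (log_mod 0%N) ?expg0 //.
  by rewrite expr0 exp1rz mul1r.
have rotM g h b : rot (g * h)%g b = rot g (rot h b).
  apply/malgP=> i; rewrite !coef_twist (log_mod (log g + log h)%N).
    by rewrite exprD expfzMl mulrA.
  by rewrite expgD !logK.
exists (AlgAction rot1 rotM); rewrite /= [LHS]twistU.
by rewrite (log_mod 1%N) ?expg1 // expr1 expr1z [RHS]laurent_scaleU.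
Qed.

(* Main.v *)
From HB Require Import structures.
Require Import Defs.
From mathcomp Require Import all_boot all_order all_algebra all_fingroup.
From mathcomp Require Import reals complex.
From mathcomp Require Import cyclic finmap boolp monalg mxtens.
Import GRing.Theory.
Local Open Scope ring_scope.

(** Write L for the Laurent polynomials in u.  The smash product A acts on L:
    coefficients by multiplication, group elements through the given action.
    The subring of Laurent polynomials in t = u^d is fixed by the group, since
    xi multiplies u^d by zeta^d = 1; so A acts by maps that are linear over
    C[t, t^-1], and L is free over that ring with basis 1, u, ..., u^(d-1).
    Taking matrices in this basis gives an algebra morphism from A to the
    d x d matrices over C[t, t^-1] ([smash_mxM]).

    It is bijective.  An element a = \sum_g a_g g sends u^q to
    \sum_g chi(g)^q a_g u^q, where chi : Gamma -> C^* is the character with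
    chi(xi) = zeta.  Because zeta is primitive, chi is injective, and the d
    elements of Gamma are matched with the d exponents q by an invertible
    discrete Fourier transform: the images of the basis vectors u^q are
    arbitrary, and the coefficients a_g are recovered from them by Fourier
    inversion ([smash_mxK], [mx_smashK], which use one orthogonality relation
    each).

    Hence A is isomorphic to the algebra of d x d matrices over C[t, t^-1], and
    n x n matrices over A become nd x nd matrices over C[t, t^-1]
    ([gl_flatten_isomorphic]).  An isomorphism of Lie algebras restricts to the
    derived algebras ([lie_isomorphic_derived]), which turns gl into sl. *)

Set Implicit Arguments.
Unset Strict Implicit.
Unset Printing Implicit Defensive.

(** * Isomorphisms of Lie algebras *)

Lemma lie_isomorphic_build (K : fieldType) (L1 L2 : lieAlgType K)
    (f : L1 -> L2) (g : L2 -> L1) :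
  linear f -> cancel f g -> cancel g f ->
  {morph f : x y / lie x y >-> lie x y} -> lie_isomorphic L1 L2.
Proof.
move=> flin fK gK fM.
pose flinM := GRing.isLinear.Build K L1 L2 *:%R f flin.
pose F : {linear L1 -> L2} := HB.pack f flinM.
by exists F; split=> //; exists g.
Qed.

Lemma mem_derived_morph (K : fieldType) (L1 L2 : lieAlgType K)
    (f : {linear L1 -> L2}) :
  {morph f : x y / lie x y >-> lie x y} ->
  forall x, x \in @derived_pred K L1 -> f x \in @derived_pred K L2.
Proof.
move=> fM x /asboolP[m [c [a [b ->]]]].
rewrite linear_sum rpred_sum //= => i _.
by rewrite linearZ_LR rpredZ //= fM mem_lie_derived.
Qed.

Lemma lie_isomorphic_derived (K : fieldType) (L1 L2 : lieAlgType K) :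
  lie_isomorphic L1 L2 -> lie_isomorphic (derived L1) (derived L2).
Proof.
move=> [f [[g fK gK] fM]].
have glin : linear g.
  by move=> k x y; apply: (can_inj fK); rewrite linearP !gK.
pose glinM := GRing.isLinear.Build K L2 L1 *:%R g glin.
pose G : {linear L2 -> L1} := HB.pack g glinM.
have gM : {morph G : x y / lie x y >-> lie x y}.
  by move=> x y; apply: (can_inj fK); rewrite fM !gK.
pose f' (x : derived L1) : derived L2 :=
  Derived (mem_derived_morph fM (valP x)).
pose g' (x : derived L2) : derived L1 :=
  Derived (mem_derived_morph gM (valP x)).
apply: (@lie_isomorphic_build _ _ _ f' g').
- by move=> k x y; apply: val_inj; rewrite /= linearP.
- by move=> x; apply: val_inj; rewrite /= fK.
- by move=> x; apply: val_inj; rewrite /= gK.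
- by move=> x y; apply: val_inj; rewrite /= fM.
Qed.

(** * Matrices over a matrix algebra *)

Lemma gl_scaleE (K : fieldType) (n : nat) (A : algType K) (k : K)
    (M : gl n A) i j :
  (k *: M) i j = k *: M i j.
Proof. exact: mxE. Qed.

(** An n x n matrix whose entries are d x d blocks is an nd x nd matrix, and
    block multiplication is matrix multiplication. *)
Lemma gl_flatten_isomorphic (K : fieldType) (n d : nat) (A B : algType K)
    (phi : {linear A -> gl d B}) :
  bijective phi -> {morph phi : x y / x * y >-> x *m y} ->
  lie_isomorphic (gl n A) (gl (n * d) B).
Proof.
move=> [psi phiK psiK] phiM.
pose f (M : gl n A) : gl (n * d) B := \matrix_(r, s)
  phi (M (mxtens_unindex r).1 (mxtens_unindex s).1)
    (mxtens_unindex r).2 (mxtens_unindex s).2.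
pose g (N : gl (n * d) B) : gl n A := \matrix_(i, j)
  psi (\matrix_(p, q) N (mxtens_index (i, p)) (mxtens_index (j, q))).
have fM M N : f (M *m N) = f M *m f N.
  apply/matrixP=> r s; rewrite !mxE raddf_sum summxE /=.
  under eq_bigr => i _ do rewrite phiM mxE.
  rewrite pair_bigA (reindex (@mxtens_unindex n d)) /=; last first.
    exists (@mxtens_index n d) => x _; first exact: mxtens_unindexK.
    exact: mxtens_indexK.
  by apply: eq_bigr => x _; rewrite !mxE.
have flin : linear f.
  move=> k M N; apply/matrixP=> r s; rewrite mxE [RHS]mxE gl_scaleE.
  by rewrite mxE gl_scaleE linearP mxE gl_scaleE !mxE.
apply: (@lie_isomorphic_build _ _ _ f g) => //.
- move=> M; apply/matrixP=> i j; rewrite mxE -[RHS]phiK; congr psi.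
  by apply/matrixP=> p q; rewrite !mxE !mxtens_indexK.
- move=> N; apply/matrixP=> r s; rewrite !mxE psiK mxE.
  by rewrite -!surjective_pairing !mxtens_unindexK.
- move=> M N.
  have fB : {morph f : x y / x - y}.
    by move=> x y; rewrite -scaleN1r addrC flin scaleN1r addrC.
  by rewrite /lie /= /commutator_mx fB !fM.
Qed.

(** * The action of a smash product on its coefficient algebra *)

Section SmashEval.
Context (K : fieldType) (gT : finGroupType) (B : algType K).
Context (act : alg_action gT B).
Implicit Types (a b : smash act) (f : B).

Definition smash_eval a f : B := \sum_g a g * act g f.

Lemma smash_evalM a b f :
  smash_eval (a * b) f = smash_eval a (smash_eval b f).
Proof.
rewrite /smash_eval.
under eq_bigr => g _ do rewrite ffunE mulr_suml.
rewrite exchange_big /=; apply: eq_bigr => h _.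
rewrite (reindex_inj (mulgI h)) /= raddf_sum mulr_sumr.
by apply: eq_bigr => k _; rewrite mulKg act_mul /= rmorphM mulrA.
Qed.

Lemma smash_eval_sum a (I : Type) (r : seq I) (P : pred I) (F : I -> B) :
  smash_eval a (\sum_(i <- r | P i) F i) =
    \sum_(i <- r | P i) smash_eval a (F i).
Proof.
rewrite /smash_eval exchange_big /=; apply: eq_bigr => g _.
by rewrite raddf_sum mulr_sumr.
Qed.
End SmashEval.

(** * Coefficients of Laurent polynomials *)

Section LaurentCoefficients.
Context (K : fieldType).
Implicit Types (a c : K) (f h : laurent K) (i j k m : int).

Lemma laurent_coefD f h m : (f + h)@_m = f@_m + h@_m.
Proof. exact: mcoeffD. Qed.

Lemma laurent_coefZ a f m : (a *: f)@_m = a * f@_m.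
Proof. exact: mcoeffZ. Qed.

Lemma laurent_coefU a k m : (<< a *g k >> : laurent K)@_m = a *+ (k == m).
Proof. exact: mcoeffU. Qed.

Lemma laurent_coef_sum (I : Type) (r : seq I) (P : pred I)
    (F : I -> laurent K) m :
  (\sum_(i <- r | P i) F i)@_m = \sum_(i <- r | P i) (F i)@_m.
Proof. exact: (raddf_sum (mcoeff m)). Qed.

Lemma laurent_coefUM a i f m :
  ((<< a *g i >> : laurent K) * f)@_m = a * f@_(m - i).
Proof.
rewrite [in LHS](laurentE f) mulr_sumr laurent_coef_sum.
rewrite [in RHS](laurentE f) laurent_coef_sum mulr_sumr.
apply: eq_bigr => j _; rewrite laurentMUU !laurent_coefU mulrnAr.
by congr (_ *+ nat_of_bool _); rewrite addrC eq_sym -subr_eq eq_sym.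
Qed.

(** The image of u determines the images of its negative powers because u is
    invertible; this also forces the multiplier c to be nonzero. *)
Lemma laurent_lrmorphism_coef (phi : {lrmorphism laurent K -> laurent K}) c :
  phi laurent_var = c *: laurent_var -> forall f m, (phi f)@_m = c ^ m * f@_m.
Proof.
pose U m : laurent K := << 1 *g m >>; rewrite -[laurent_var]/(U 1) => phiu.
have UM i j : U i * U j = U (i + j) by rewrite /U laurentMUU mulr1.
have UK m : U (- m) * U m = 1 by rewrite UM addNr.
have c0 : c != 0.
  apply/eqP => c0; have := rmorph1 phi.
  rewrite -(UK 1) rmorphM /= phiu c0 scale0r mulr0 => /esym/eqP.
  by rewrite UK oner_eq0.
have phiUn n : phi (U n%:Z) = c ^ n *: U n%:Z.
  elim: n => [|n IH]; first by rewrite rmorph1 expr0z scale1r.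
  rewrite -addn1 PoszD -UM rmorphM /= IH phiu expfzDr // expr1z.
  by rewrite -scalerAl -scalerAr scalerA.
have phiU m : phi (U m) = c ^ m *: U m.
  case: (intP m) => [|n|n]; [exact: phiUn|exact: phiUn|].
  rewrite -[LHS]mul1r -(UK n.+1%:Z) -mulrA.
  have -> : U n.+1 = c ^ (- n.+1%:Z) *: phi (U n.+1).
    by rewrite phiUn scalerA -expfzDr // addNr expr0z scale1r.
  by rewrite -scalerAl -rmorphM UM subrr /= rmorph1 -scalerAr mulr1.
move=> f m; rewrite [in LHS](laurentE f) raddf_sum laurent_coef_sum /=.
rewrite [in RHS](laurentE f) laurent_coef_sum mulr_sumr.
apply: eq_bigr => j _.
have -> : << f@_j *g j >> = f@_j *: U j by rewrite laurent_scaleU mulr1.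
rewrite linearZ /= phiU !laurent_coefZ laurent_coefU mulrCA.
by case: eqP => [->//|]; rewrite !mulr0.
Qed.
End LaurentCoefficients.

(** * Laurent polynomials in u as a free module over those in u^d *)

Section DilatedLaurent.
Context (K : fieldType) (d : nat) (d_gt0 : (0 < d)%N).
Implicit Types (f h : laurent K) (i j k m : int).

(** The substitution u := u^d, through which a Laurent polynomial in t acts on those in u. *)
Definition dilate h : laurent K :=
  \sum_(k <- msupp h) << h@_k *g k * d%:Z >>.

(** The coordinate of [f] on the basis vector u^i, as a Laurent polynomial in
    t = u^d: it collects the coefficients of [f] in degrees congruent to [i]
    modulo [d]. *)
Definition component i f : laurent K :=
  [malg k in [fset ((m - i) %/ d)%Z | m in msupp f]%fset => f@_(i + k * d%:Z)].

Let dz_neq0 : d%:Z != 0.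
Proof. by rewrite eqz_nat -lt0n. Qed.

Lemma component_coef i f k : (component i f)@_k = f@_(i + k * d%:Z).
Proof.
rewrite mcoeffE; case: ifP => // /negbT kN; apply/esym/mcoeff_outdom.
apply: contra kN => kS; apply/imfsetP; exists (i + k * d%:Z) => //=.
by rewrite addrAC subrr add0r mulzK.
Qed.

Lemma component_linear i : linear (component i).
Proof.
move=> a f g; apply/malgP=> k; rewrite laurent_coefD laurent_coefZ.
by rewrite !component_coef laurent_coefD laurent_coefZ.
Qed.

HB.instance Definition _ i :=
  GRing.isLinear.Build K (laurent K) (laurent K) *:%R (component i)
    (component_linear i).

Lemma component_dilateM i h f :
  component i (dilate h * f) = h * component i f.
Proof.
apply/malgP=> k; rewrite component_coef [in RHS](laurentE h) !mulr_suml.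
rewrite !laurent_coef_sum; apply: eq_bigr => l _.
by rewrite !laurent_coefUM component_coef mulrBl addrA.
Qed.

Lemma component_monomial (p q : 'I_d) :
  component p%:Z << 1 *g q%:Z >> = (p == q)%:R.
Proof.
apply/malgP=> k; rewrite component_coef laurent_coefU.
have -> : (p == q)%:R = << (p == q)%:R *g (0 : int) >> :> laurent K.
  by case: (p == q); rewrite ?monalgU0.
rewrite laurent_coefU -mulrnA mulnb; congr (_ *+ nat_of_bool _).
case: (eqVneq p q) => [->|pq] /=.
  rewrite -subr_eq0 opprD addNKr oppr_eq0 mulf_eq0 (negPf dz_neq0) orbF.
  by rewrite eq_sym.
apply/negP=> /eqP e; case/eqP: pq; apply: val_inj => /=.
have /= := congr1 (fun z => (z %% d)%Z) e; rewrite addrC modzMDl.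
by rewrite !modz_small ?lez_nat ?ltz_nat ?ltn_ord // => -[].
Qed.

Lemma dilate_coef h k : (dilate h)@_(k * d%:Z) = h@_k.
Proof.
rewrite laurent_coef_sum [in RHS](laurentE h) laurent_coef_sum.
apply: eq_bigr => l _.
by rewrite !laurent_coefU (inj_eq (mulIf dz_neq0)).
Qed.

Lemma dilate_coef_out h m : ~~ (d %| m)%Z -> (dilate h)@_m = 0.
Proof.
move=> dm; rewrite laurent_coef_sum big1 // => l _; rewrite laurent_coefU.
by case: eqP => // e; rewrite -e dvdz_mull in dm.
Qed.

(** In degree m only the remainder of m modulo d contributes to the sum. *)
Lemma component_decomposition f :
  f = \sum_(p < d) dilate (component p%:Z f) * << 1 *g p%:Z >>.
Proof.
apply/malgP=> m; rewrite laurent_coef_sum.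
have mod_lt : (`|(m %% d)%Z| < d)%N.
  by rewrite -ltz_nat gez0_abs ?modz_ge0 // ltz_pmod.
have modE : `|(m %% d)%Z|%N%:Z = (m %% d)%Z by rewrite gez0_abs ?modz_ge0.
rewrite (bigD1 (Ordinal mod_lt)) //= mulrC laurent_coefUM mul1r modE.
have -> : m - (m %% d)%Z = (m %/ d)%Z * d by rewrite {1}(divz_eq m d) addrK.
rewrite dilate_coef component_coef (addrC (m %% d)%Z) -divz_eq.
rewrite big1 ?addr0 // => p ne.
rewrite mulrC laurent_coefUM mul1r dilate_coef_out //.
apply: contra ne => dv; apply/eqP/val_inj => /=.
apply/eqP; rewrite -eqz_nat modE.
rewrite -eqz_mod_dvd in dv.
by move/eqP: dv => ->; rewrite modz_small // lez_nat ltz_nat ltn_ord.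
Qed.

(** * The smash product as a matrix algebra *)

Section RotationMatrices.
Context (gT : finGroupType) (act : alg_action gT (laurent K)).
Context (chi : gT -> K) (xi : gT).
Hypothesis actE : forall g f m, (act g f)@_m = chi g ^ m * f@_m.
Hypothesis chiM : {morph chi : g h / (g * h)%g >-> g * h}.
Hypothesis chi_inj : injective chi.
Hypothesis chi_order : forall g, chi g ^+ d = 1.
Hypothesis chi_xi : d.-primitive_root (chi xi).
Hypothesis card_gT : #|gT| = d.
Implicit Types a b : smash act.

Let U m : laurent K := << 1 *g m >>.

Let UM i j : U i * U j = U (i + j).
Proof. by rewrite /U laurentMUU mulr1. Qed.

Let d_neq0 : d%:R != 0 :> K.
Proof. exact: prim_root_natf_neq0 chi_xi. Qed.

Let chi_neq0 g : chi g != 0.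
Proof.
apply: contra_eq_neq (chi_order g) => ->.
by rewrite expr0n gtn_eqF // eq_sym oner_neq0.
Qed.

Lemma smash_eval_monomial a m :
  smash_eval a (U m) = \sum_g chi g ^ m *: (a g * U m).
Proof.
apply: eq_bigr => g _; rewrite scalerAr; congr (_ * _).
apply/malgP=> k; rewrite actE laurent_coefZ laurent_coefU.
by case: eqP => [->//|]; rewrite !mulr0.
Qed.

Lemma act_dilate g h : act g (dilate h) = dilate h.
Proof.
apply/malgP=> m; rewrite actE.
have [/dvdzP[k ->]|/dilate_coef_out ->] := boolP (d %| m)%Z; last first.
  by rewrite mulr0.
by rewrite (mulrC k) -exprz_exp -exprnP chi_order exp1rz mul1r.
Qed.

Lemma smash_eval_dilate a h f :
  smash_eval a (dilate h * f) = dilate h * smash_eval a f.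
Proof.
rewrite mulr_sumr; apply: eq_bigr => g _.
by rewrite rmorphM /= act_dilate mulrCA.
Qed.

Lemma sum_root_of_unity (x : K) : x ^+ d = 1 ->
  \sum_(q < d) x ^+ q = d%:R *+ (x == 1).
Proof.
move=> xd; case: eqP => [->|/eqP x1].
  rewrite (eq_bigr (fun=> 1)) => [|q _]; last by rewrite expr1n.
  by rewrite sumr_const card_ord.
apply: (mulfI (_ : x - 1 != 0)); first by rewrite subr_eq0.
by rewrite -subrX1 xd subrr mulr0.
Qed.

(** Translating the summation variable by xi multiplies the sum by
    chi(xi)^(p - q), which differs from 1 unless p = q. *)
Lemma sum_character (p q : 'I_d) :
  \sum_g chi g ^ (p%:Z - q%:Z) = d%:R *+ (p == q).
Proof.
case: eqVneq => [->|pq].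
  by rewrite subrr (eq_bigr (fun=> 1)) // sumr_const card_gT.
set z := chi xi ^ (p%:Z - q%:Z); set S := \sum_g _.
have zS : z * S = S.
  rewrite {2}/S (reindex_inj (mulgI xi)) mulr_sumr /=.
  by apply: eq_bigr => g _; rewrite chiM expfzMl.
apply: (mulfI (_ : z - 1 != 0)); last first.
  by rewrite mulrBl zS mul1r subrr mulr0.
rewrite subr_eq0; apply: contra pq => /eqP z1.
have : chi xi ^+ p == chi xi ^+ q.
  by rewrite !exprnP -[p%:Z](subrK q%:Z) expfzDr // -/z z1 mul1r.
by rewrite (eq_prim_root_expr chi_xi) !modn_small.
Qed.

Definition smash_mx a : gl d (laurent K) :=
  \matrix_(p, q) component p%:Z (smash_eval a (U q%:Z)).

(** Fourier inversion: the inner sum is the prescribed image F_q of u^q, and an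
    element with these images has coefficients
    a_g = d^-1 \sum_q chi(g)^-q F_q u^-q. *)
Definition mx_smash (M : gl d (laurent K)) : smash act :=
  [ffun g => d%:R^-1 *: \sum_(q < d) chi g ^ (- q%:Z) *:
    ((\sum_(p < d) dilate (M p q) * U p%:Z) * U (- q%:Z))].

Lemma smash_mxE a (p q : 'I_d) :
  smash_mx a p q = component p%:Z (smash_eval a (U q%:Z)).
Proof. exact: mxE. Qed.

Lemma smash_mx_linear : linear smash_mx.
Proof.
move=> k a b; apply/matrixP=> p q.
transitivity
  (component p%:Z (k *: smash_eval a (U q%:Z) + smash_eval b (U q%:Z))).
  rewrite [LHS]smash_mxE; congr component.
  rewrite scaler_sumr -big_split; apply: eq_bigr => g _.
  by rewrite !ffunE mulrDl scalerAl.
rewrite component_linear [RHS]mxE gl_scaleE.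
exact: esym
  (congr2 (fun x y => k *: x + y) (smash_mxE a p q) (smash_mxE b p q)).
Qed.

Lemma smash_mxM a b : smash_mx (a * b) = smash_mx a *m smash_mx b.
Proof.
apply/matrixP=> p q; rewrite smash_mxE [RHS]mxE smash_evalM.
rewrite [smash_eval b _]component_decomposition smash_eval_sum linear_sum /=.
apply: eq_bigr => r _; rewrite smash_eval_dilate component_dilateM mulrC.
exact: esym (congr2 *%R (smash_mxE a p r) (smash_mxE b r q)).
Qed.

Lemma smash_mxK : cancel smash_mx mx_smash.
Proof.
move=> a; apply/ffunP=> g; rewrite ffunE.
transitivity (d%:R^-1 *: \sum_(q < d) \sum_h (chi h / chi g) ^+ q *: a h).
  congr (_ *: _); apply: eq_bigr => q _.
  under eq_bigr => p _ do rewrite mxE.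
  rewrite -component_decomposition smash_eval_monomial mulr_suml scaler_sumr.
  apply: eq_bigr => h _; rewrite -scalerAl -mulrA UM subrr mulr1 scalerA.
  by rewrite exprMn exprVn mulrC -!exprnP -invr_expz.
rewrite exchange_big (bigD1 g) //= [X in _ + X]big1 => [|h hg].
  rewrite -scaler_suml sum_root_of_unity ?divff // ?expr1n // eqxx.
  by rewrite addr0 scalerA mulVf // scale1r.
rewrite -scaler_suml sum_root_of_unity; last first.
  by rewrite exprMn exprVn !chi_order invr1 mulr1.
rewrite -(inj_eq (mulIf (chi_neq0 g))) divfK // mul1r (inj_eq chi_inj).
by rewrite (negPf hg) scale0r.
Qed.

Lemma mx_smash_eval M (q : 'I_d) :
  smash_eval (mx_smash M) (U q%:Z) = \sum_(p < d) dilate (M p q) * U p%:Z.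
Proof.
pose F r := \sum_(p < d) dilate (M p r) * U p%:Z.
rewrite smash_eval_monomial -/(F q).
transitivity (d%:R^-1 *: \sum_(r < d) \sum_g chi g ^ (q%:Z - r%:Z) *:
                (F r * U (q%:Z - r%:Z))).
  rewrite exchange_big scaler_sumr; apply: eq_bigr => g _; rewrite ffunE /=.
  rewrite -scalerAl scalerA mulrC -scalerA mulr_suml; congr (_ *: _).
  rewrite scaler_sumr; apply: eq_bigr => r _.
  rewrite -scalerAl scalerA -(expfzDr _ _ (chi_neq0 g)) -mulrA UM.
  by rewrite (addrC (- _)).
under eq_bigr => r _ do rewrite -scaler_suml sum_character.
rewrite (bigD1 q) //= eqxx big1 => [|r]; last first.
  by rewrite eq_sym => /negPf ->; rewrite scale0r.
by rewrite addr0 subrr mulr1 scalerA mulVf // scale1r.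
Qed.

Lemma mx_smashK : cancel mx_smash smash_mx.
Proof.
move=> M; apply/matrixP=> p q; rewrite mxE mx_smash_eval linear_sum /=.
under eq_bigr => r _ do rewrite component_dilateM component_monomial.
rewrite (bigD1 p) //= eqxx mulr1 big1 ?addr0 // => r.
by rewrite eq_sym => /negPf ->; rewrite mulr0.
Qed.
End RotationMatrices.
End DilatedLaurent.

Lemma rotation_character (K : fieldType) (gT : finGroupType)
    (xi : gT) (zeta : K) (act : alg_action gT (laurent K)) :
  [set: gT]%g = <[xi]>%g -> act xi laurent_var = zeta *: laurent_var ->
  exists chi : gT -> K,
    (forall i, chi (xi ^+ i)%g = zeta ^+ i) /\
    (forall g f m, (act g f)@_m = chi g ^ m * f@_m).
Proof.
move=> gen_xi act_xi.
have act_exp i : act (xi ^+ i)%g laurent_var = zeta ^+ i *: laurent_var.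
  elim: i => [|i IH]; first by rewrite expg0 act_id scale1r.
  by rewrite expgS act_mul IH linearZ /= act_xi scalerA exprSr.
(* Reading chi off the image of u makes it well defined on the whole group. *)
pose chi g := (act g laurent_var)@_1.
have chi_exp i : chi (xi ^+ i)%g = zeta ^+ i.
  by rewrite /chi act_exp laurent_coefZ laurent_coefU eqxx mulr1.
exists chi; split=> // g f m.
have /cycleP[i ->] : g \in <[xi]>%g by rewrite -gen_xi inE.
by rewrite chi_exp; apply: laurent_lrmorphism_coef (act_exp i) f m.
Qed.

Theorem smash_rotation_matrix (K : fieldType) (d : nat) (gT : finGroupType)
    (xi : gT) (zeta : K) (act : alg_action gT (laurent K)) :
  [set: gT]%g = <[xi]>%g -> #[xi]%g = d -> d.-primitive_root zeta ->
  act xi laurent_var = zeta *: laurent_var ->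
  exists phi : {linear smash act -> gl d (laurent K)},
    bijective phi /\ {morph phi : a b / a * b >-> a *m b}.
Proof.
move=> gen_xi ord_xi prim_zeta act_xi.
have d_gt0 := prim_order_gt0 prim_zeta.
have [chi [chi_exp actE]] := rotation_character gen_xi act_xi.
have xiP g : exists i, g = (xi ^+ i)%g by apply/cycleP; rewrite -gen_xi inE.
have chiM : {morph chi : g h / (g * h)%g >-> g * h}.
  move=> g h; have [i ->] := xiP g; have [j ->] := xiP h.
  by rewrite -expgD !chi_exp exprD.
have chi_inj : injective chi.
  move=> g h; have [i ->] := xiP g; have [j ->] := xiP h.
  rewrite !chi_exp => /eqP; rewrite (eq_prim_root_expr prim_zeta) -ord_xi.
  by rewrite -eq_expg_mod_order => /eqP.
have chi_order g : chi g ^+ d = 1.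
  have [i ->] := xiP g.
  by rewrite chi_exp exprAC (prim_expr_order prim_zeta) expr1n.
have chi_xi : d.-primitive_root (chi xi) by rewrite -[xi]expg1 chi_exp.
have card_gT : #|gT| = d by rewrite -cardsT gen_xi.
pose philin := GRing.isLinear.Build K (smash act) (gl d (laurent K)) *:%R
  (@smash_mx K d gT act) (smash_mx_linear d_gt0 (act := act)).
pose phi : {linear smash act -> gl d (laurent K)} :=
  HB.pack (@smash_mx K d gT act) philin.
exists phi; split; last exact: (smash_mxM d_gt0 actE chi_order).
exists (@mx_smash K d gT act chi).
  exact: (smash_mxK d_gt0 actE chi_inj chi_order chi_xi).
exact: (mx_smashK d_gt0 actE chiM chi_order chi_xi card_gT).
Qed.

Theorem proposition3p8 (R : realType) (n d : nat) (hn : (2 <= n)%N)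
    (hd : (1 <= d)%N)
    (Gamma : finGroupType) (xi : Gamma)
    (hGamma : [set: Gamma]%g = <[xi]>%g) (hxi : #[xi]%g = d)
    (zeta : R[i]) (hzeta : d.-primitive_root zeta)
    (act : alg_action Gamma (laurent R[i]))
    (hact : act xi laurent_var = zeta *: laurent_var) :
  lie_isomorphic (sl n (smash act)) (sl (n * d)%N (laurent R[i])).
Proof.
have [phi [phi_bij phiM]] := smash_rotation_matrix hGamma hxi hzeta hact.
exact: lie_isomorphic_derived (gl_flatten_isomorphic n phi_bij phiM).
Qed.
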